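(* Let $m_3(s) = f_0 + g^T s + \frac12 H[s]^2 + \frac16 T[s]^3 + \frac{\sigma}{4}\|s\|_W^4$ for $s\in\mathbb{R}^n$. Assume that $s_*\in\mathbb{R}^n$, $s_*\neq 0$, satisfies $$\Big(H + \tfrac12 T[s_*] + \sigma\|s_*\|_W^2 W\Big)s_* = -g$$ and that $\sigma$ satisfies $$\sigma \ge 3\max\Big\{-\lambda_{\min}[H]\,\|s_*\|_W^{-2}\,\lambda_{\min}(W)^{-1},\ \ \tfrac73\Lambda_W\|s_*\|_W^{-1}\Big\}.$$ Then the two conditions $$\text{(N)}\quad H + \frac23 T[s_*] + \sigma\|s_*\|_W^2 W + \frac{\Lambda_W}{3}\|s_*\|_W W \succeq 0$$ and $$\text{(S)}\quad H + \frac23 T[s_*] + \sigma\|s_*\|_W^2 W - \frac{\Lambda_W}{3}\|s_*\|_W W - \frac{\Lambda_W^2}{18\sigma}W \succeq 0$$ are equivalent. Moreover, if in addition (N) holds, then $s_*$ is a global minimizer of $m_3$ over $\mathbb{R}^n$.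
   Context: Here $f_0\in\mathbb{R}$, $g\in\mathbb{R}^n$, $H\in\mathbb{R}^{n\times n}$ is a symmetric matrix, $T\in\mathbb{R}^{n\times n\times n}$ is a symmetric third-order tensor (entries invariant under permutation of indices), $\sigma>0$, and $W\in\mathbb{R}^{n\times n}$ is symmetric positive definite, with $\|v\|_W=\sqrt{v^TWv}$. Notation: $H[s]^2=s^THs$; $T[s]^3=\sum_{i,j,k}T_{ijk}s_is_js_k$; $T[s]$ is the symmetric matrix with entries $\sum_k T_{ijk}s_k$; $T[u][v]^2=\sum_{i,j,k}T_{ijk}u_iv_jv_k$. $\lambda_{\min}$ denotes the smallest eigenvalue. The weighted tensor norm is $$\Lambda_W=\max_{u,v\in\mathbb{R}^n\setminus\{0\}}\frac{|T[u][v]^2|}{\|u\|_W\|v\|_W^2}.$$ $A\succeq 0$ means that the symmetric matrix $A$ is positive semidefinite. *)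

(* Defs.v *)
From mathcomp Require Import all_boot all_order all_algebra.
From mathcomp Require Import classical_sets reals.

Set Implicit Arguments.
Unset Strict Implicit.
Unset Printing Implicit Defensive.

Import Order.TTheory GRing.Theory Num.Theory.
Local Open Scope ring_scope.
Local Open Scope classical_set_scope.

Section Definitions.
Variables (R : realType) (n : nat).
Implicit Types (A H W : 'M[R]_n) (T : 'I_n -> 'I_n -> 'I_n -> R).
Implicit Types (g s u v : 'cV[R]_n).

Definition quad A v : R := (v^T *m A *m v) 0 0.

Definition psdmx A : Prop :=
  A \is symmetricmx /\ forall v, 0 <= quad A v.

Definition pdmx A : Prop :=
  A \is symmetricmx /\ forall v, v != 0 -> 0 < quad A v.

(* MathComp's [eigenvalue] uses row eigenvectors, i.e. it gives the eigenvalues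
   of the transpose; the spectrum is the same.  For a symmetric matrix of
   positive size the set below is finite and nonempty, so the infimum is the
   smallest eigenvalue. *)
Definition lambda_min A : R := inf [set a : R | eigenvalue A a].

Definition normW W v : R := Num.sqrt (quad W v).

Definition symmetric_tensor T : Prop := forall i j k,
  [/\ T i j k = T i k j, T i j k = T j i k, T i j k = T j k i,
      T i j k = T k i j & T i j k = T k j i].

Definition tensor_mx T s : 'M[R]_n :=
  \matrix_(i < n, j < n) \sum_(k < n) T i j k * s k 0.

Definition tensor_cube T s : R :=
  \sum_(i < n) \sum_(j < n) \sum_(k < n) T i j k * s i 0 * s j 0 * s k 0.

Definition tensor_app T u v : R :=
  \sum_(i < n) \sum_(j < n) \sum_(k < n) T i j k * u i 0 * v j 0 * v k 0.

(* For 0 < n and W positive definite, the ratio attains its maximum (by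
   homogeneity it suffices to let u and v range over the compact W-unit sphere),
   so the supremum is the maximum. *)
Definition Lambda T W : R :=
  sup [set x : R | exists u v, [/\ u != 0, v != 0 &
    x = `|tensor_app T u v| / (normW W u * normW W v ^+ 2)]].

Definition m3 (f0 : R) g H T (sigma : R) W s : R :=
  f0 + (g^T *m s) 0 0 + 2^-1 * quad H s + 6^-1 * tensor_cube T s
  + sigma / 4 * normW W s ^+ 4.

End Definitions.

(* Main.v *)
(** Put [r = |s_|_W] and [G = H + (2/3) T[s_] + sigma r^2 W].  The lower bound
    on [sigma] gives [H >= - (sigma r^2 / 3) W] and [sigma r >= 7 Lambda], which
    already force (S), hence also (N).  For the minimality, the first order
    condition turns [m3 (s_ + v) - m3 s_] into
      [G[v]^2 / 2 + T[s_ + v][v]^2 / 6 + sigma / 4 (p^2 - r^2)^2]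
    with [p = |s_ + v|_W].  Since [|v|_W <= p + r], this is at least
      [G[v]^2 / 2 - Lambda p |v|_W^2 / 6 + sigma / 4 (p - r)^2 |v|_W^2],
    and minimizing over [p - r] leaves half of the quadratic form in (S). *)

Require Import Defs.
From mathcomp Require Import all_boot all_order all_algebra.
From mathcomp Require Import classical_sets reals.
From mathcomp Require Import ring lra.
Import Order.TTheory GRing.Theory Num.Theory.
Local Open Scope ring_scope.

Set Implicit Arguments.
Unset Strict Implicit.
Unset Printing Implicit Defensive.

(** * Bilinear forms, smallest eigenvalues and the norm of [W] *)

Section BilinearForm.
Context {R : realType} {n : nat}.
Implicit Types (A B W : 'M[R]_n) (u v x y : 'cV[R]_n).

Lemma symmetricmxE A : (A \is symmetricmx) = (A^T == A).
Proof. by apply/is_hermitianmxP/eqP; rewrite expr0 scale1r map_mx_id. Qed.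

Definition bilin A u v : R := (u^T *m A *m v) 0 0.

Lemma quadE A v : quad A v = bilin A v v. Proof. by []. Qed.

Lemma quad0 A : quad A 0 = 0.
Proof. by rewrite /quad mulmx0 mxE. Qed.

Lemma bilin_mx11 u v : (u^T *m v) 0 0 = bilin 1%:M u v.
Proof. by rewrite /bilin mulmx1. Qed.

Lemma bilinDl A u v y : bilin A (u + v) y = bilin A u y + bilin A v y.
Proof. by rewrite /bilin linearD /= !mulmxDl mxE. Qed.

Lemma bilinDr A u v y : bilin A y (u + v) = bilin A y u + bilin A y v.
Proof. by rewrite /bilin mulmxDr mxE. Qed.

Lemma bilinZl A a u v : bilin A (a *: u) v = a * bilin A u v.
Proof. by rewrite /bilin linearZ /= -!scalemxAl mxE. Qed.

Lemma bilinZr A a u v : bilin A u (a *: v) = a * bilin A u v.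
Proof. by rewrite /bilin -scalemxAr mxE. Qed.

Lemma bilinDm A B u v : bilin (A + B) u v = bilin A u v + bilin B u v.
Proof. by rewrite /bilin mulmxDr mulmxDl mxE. Qed.

Lemma bilinNm A u v : bilin (- A) u v = - bilin A u v.
Proof. by rewrite /bilin mulmxN mulNmx mxE. Qed.

Lemma bilinZm a A u v : bilin (a *: A) u v = a * bilin A u v.
Proof. by rewrite /bilin -scalemxAr -scalemxAl mxE. Qed.

Lemma bilinC A u v : A \is symmetricmx -> bilin A u v = bilin A v u.
Proof.
rewrite symmetricmxE => /eqP AT.
by rewrite /bilin -[in LHS](trmxK (u^T *m A *m v)) mxE !trmx_mul trmxK AT mulmxA.
Qed.

Lemma bilin_mul A u v : bilin A u v = bilin 1%:M u (A *m v).
Proof. by rewrite /bilin mulmx1 mulmxA. Qed.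

Lemma bilin_sum A u v :
  bilin A u v = \sum_i \sum_j A i j * u i 0 * v j 0.
Proof.
rewrite /bilin mxE exchange_big /=; apply: eq_bigr => j _.
rewrite mxE big_distrl /=; apply: eq_bigr => i _.
by rewrite mxE; ring.
Qed.

Definition sqnorm v : R := \sum_i v i 0 ^+ 2.

Lemma bilin1 v : bilin 1%:M v v = sqnorm v.
Proof.
by rewrite -bilin_mx11 mxE; apply: eq_bigr => i _; rewrite mxE expr2.
Qed.

Lemma sqnorm_ge0 v : 0 <= sqnorm v.
Proof. by apply: sumr_ge0 => i _; apply: sqr_ge0. Qed.

Lemma sqr_le_sqnorm v i : v i 0 ^+ 2 <= sqnorm v.
Proof.
rewrite /sqnorm (bigD1 i) //= lerDl.
by apply: sumr_ge0 => j _; apply: sqr_ge0.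
Qed.

Lemma sqnorm_eq0 v : (sqnorm v == 0) = (v == 0).
Proof.
apply/eqP/eqP => [v0|->]; last first.
  by rewrite /sqnorm big1 // => i _; rewrite mxE expr0n.
apply/matrixP => i j; rewrite (ord1 j) mxE; apply/eqP.
by rewrite -sqrf_eq0 eq_le sqr_ge0 andbT -v0 sqr_le_sqnorm.
Qed.

Lemma sqnorm_gt0 v : (0 < sqnorm v) = (v != 0).
Proof. by rewrite lt_def sqnorm_eq0 sqnorm_ge0 andbT. Qed.

Lemma normr_quad_le A :
  exists2 C, 0 <= C & forall v, `|quad A v| <= C * sqnorm v.
Proof.
exists (\sum_i \sum_j `|A i j|).
  by apply: sumr_ge0 => i _; apply: sumr_ge0 => j _.
move=> v; rewrite quadE bilin_sum mulr_suml.
apply: (le_trans (ler_norm_sum _ _ _)); apply: ler_sum => i _.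
rewrite mulr_suml.
apply: (le_trans (ler_norm_sum _ _ _)); apply: ler_sum => j _.
rewrite -mulrA normrM ler_wpM2l // normrM.
have hi := sqr_le_sqnorm v i; have hj := sqr_le_sqnorm v j.
rewrite -real_normK ?num_real // in hi.
rewrite -real_normK ?num_real // in hj.
by nra.
Qed.

(** The form is nonnegative on every combination [x *: u + y *: v]. As [B] may be singular, no
    division is available at first, and suitable [x], [y] are chosen in each case. *)
Lemma psd_cauchy_schwarz B u v : psdmx B ->
  bilin B u v ^+ 2 <= quad B u * quad B v.
Proof.
move=> [Bsym Bge0].
have P (x y : R) : 0 <= x ^+ 2 * quad B u + 2 * x * y * bilin B u v
                  + y ^+ 2 * quad B v.
  have := Bge0 (x *: u + y *: v).
  rewrite quadE !bilinDl !bilinDr !bilinZl !bilinZr (bilinC v u) // -!quadE.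
  by congr (0 <= _); ring.
have := Bge0 u; have := Bge0 v.
set a := quad B u in P *; set b := quad B v in P *.
set c := bilin B u v in P *.
rewrite [0 <= b]le_eqVlt => /orP[/eqP b0|b_gt0] a_ge0.
  move: a_ge0; rewrite le_eqVlt => /orP[/eqP a0|a_gt0].
    (* With both diagonal values zero, the form at [(1, - c)] is [- 2 c^2], which forces [c = 0]. *)
    by have := P 1 (- c); rewrite -a0 -b0; nra.
  have := P (- c) a; rewrite -b0 => h.
  have : 0 <= a * (- c ^+ 2) by nra.
  by rewrite pmulr_rge0 // mulr0 oppr_ge0.
(* The form at [(b, - c)] is exactly this product. *)
have h : 0 <= b * (a * b - c ^+ 2).
  by apply: le_trans (P b (- c)) _; rewrite le_eqVlt; apply/orP; left; apply/eqP; ring.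
by move: h; rewrite pmulr_rge0 // subr_ge0.
Qed.

(** This replaces a compactness argument. With [y = B v], invertibility bounds [|v|^2] by [D |y|^2],
    and Cauchy-Schwarz bounds [|y|^2] by [C] times the form at [v]. *)
Lemma psd_unit_coercive B : psdmx B -> B \in unitmx ->
  exists2 c, 0 < c & forall v, c * sqnorm v <= quad B v.
Proof.
move=> Bpsd Bu; have [Bsym Bge0] := Bpsd.
have [C C0 HC] := normr_quad_le B.
have [D D0 HD] := normr_quad_le ((invmx B)^T *m invmx B).
(* The added [1] keeps the denominator positive even when [D * C] vanishes. *)
exists (D * C + 1)^-1; first by rewrite invr_gt0 ltr_wpDl // mulr_ge0.
move=> v; rewrite ler_pdivrMl; last by rewrite ltr_wpDl // mulr_ge0.
set y := B *m v.
have hv : sqnorm v <= D * sqnorm y.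
  have -> : sqnorm v = quad ((invmx B)^T *m invmx B) y.
    rewrite -bilin1 -bilin_mx11 /quad /y.
    by rewrite -{1 2}[v](mulKmx Bu) trmx_mul !mulmxA.
  by apply: le_trans (HD y); apply: ler_norm.
have hy : sqnorm y <= C * quad B v.
  (* Here [bilin B y v] equals [|y|^2], so the inequality reads [|y|^4 <= quad B y * quad B v]; one
     factor [|y|^2] is then cancelled. *)
  have := psd_cauchy_schwarz y v Bpsd.
  rewrite bilin_mul bilin1 => cs.
  have := HC y; rewrite ger0_norm // => hq.
  have := Bge0 v => qv; have := sqnorm_ge0 y.
  rewrite le_eqVlt => /orP[/eqP <-|y0]; first by rewrite mulr_ge0.
  rewrite -(ler_pM2l y0) -expr2 (le_trans cs) //.
  by rewrite mulrA [_ * C]mulrC ler_wpM2r.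
have qv := Bge0 v.
by have := ler_wpM2l D0 hy; nra.
Qed.

Lemma psdmxB_scalar A a : A \is symmetricmx ->
  (forall v, a * sqnorm v <= quad A v) -> psdmx (A - a%:M).
Proof.
move=> Asym h; split; last first.
  by move=> v; rewrite quadE bilinDm bilinNm -scalemx1 bilinZm bilin1 subr_ge0.
by move: Asym; rewrite !symmetricmxE linearB /= tr_scalar_mx => /eqP ->.
Qed.

(* The infimum [mu] of the Rayleigh quotient is an eigenvalue: otherwise
   [A - mu I] would be positive semidefinite and invertible, hence coercive,
   and the infimum could be improved. *)
Lemma rayleigh_min A : (0 < n)%N -> A \is symmetricmx ->
  exists2 mu, eigenvalue A mu & forall v, mu * sqnorm v <= quad A v.
Proof.
move=> n0 Asym; have [C C0 HC] := normr_quad_le A.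
pose E := [set x : R | exists2 v : 'cV[R]_n, v != 0 & x = quad A v / sqnorm v]%classic.
have v1 : exists v : 'cV[R]_n, v != 0.
  exists (const_mx 1); apply/eqP => /matrixP/(_ (Ordinal n0) 0).
  by rewrite !mxE => /eqP; rewrite oner_eq0.
have E0 : (E !=set0)%classic.
  by have [v v0] := v1; exists (quad A v / sqnorm v); exists v.
have El : has_lbound E.
  exists (- C) => _ [v v0 ->]; rewrite ler_pdivlMr ?sqnorm_gt0 //.
  by have := HC v; rewrite ler_norml mulNr => /andP[].
have h v : inf E * sqnorm v <= quad A v.
  have [->|v0] := eqVneq v 0.
    have /eqP -> : sqnorm 0 == 0 by rewrite sqnorm_eq0.
    by rewrite mulr0 quad0.
  rewrite -ler_pdivlMr ?sqnorm_gt0 //.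
  by apply: ge_inf => //; exists v.
exists (inf E) => //; rewrite /eigenvalue /eigenspace kermx_eq0 row_free_unit.
apply/negP => Bu.
have [c c0 hc] := psd_unit_coercive (psdmxB_scalar Asym h) Bu.
suff : inf E + c <= inf E by rewrite gerDl leNgt c0.
apply: lb_le_inf => // _ [v v0 ->]; rewrite ler_pdivlMr ?sqnorm_gt0 //.
have := hc v; rewrite [quad (_ - _) _]quadE bilinDm bilinNm -scalemx1 bilinZm bilin1.
by rewrite -quadE; lra.
Qed.

Lemma symmetric_eigenvalue_quad A a : A \is symmetricmx -> eigenvalue A a ->
  exists2 v, v != 0 & quad A v = a * sqnorm v.
Proof.
move=> Asym /eigenvalueP[u uA u0]; exists u^T.
  by apply: contra u0 => /eqP u0; rewrite -[u]trmxK u0 trmx0.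
by rewrite /quad trmxK uA -scalemxAl mxE -{1}[u]trmxK bilin_mx11 bilin1.
Qed.

(** Every eigenvalue is the Rayleigh quotient of an eigenvector, so the [mu] of [rayleigh_min] is a
    lower bound of the spectrum that belongs to it. The infimum is therefore attained at [mu]. *)
Lemma lambda_minP A : (0 < n)%N -> A \is symmetricmx ->
  eigenvalue A (lambda_min A) /\ forall v, lambda_min A * sqnorm v <= quad A v.
Proof.
move=> n0 Asym; have [mu mue h] := rayleigh_min n0 Asym.
suff -> : lambda_min A = mu by [].
have lb : lbound [set a : R | eigenvalue A a] mu.
  move=> a /= /(symmetric_eigenvalue_quad Asym)[v v0 e].
  by have := h v; rewrite e ler_pM2r ?sqnorm_gt0.
apply/eqP; rewrite eq_le; apply/andP; split.
  by apply: ge_inf => //; exists mu.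
by apply: lb_le_inf => //; exists mu.
Qed.

Lemma lambda_min_gt0 W : (0 < n)%N -> pdmx W -> 0 < lambda_min W.
Proof.
move=> n0 [Wsym Wpd]; have [e _] := lambda_minP n0 Wsym.
have [v v0 ev] := symmetric_eigenvalue_quad Wsym e.
by have := Wpd v v0; rewrite ev pmulr_lgt0 // sqnorm_gt0.
Qed.

Lemma pdmx_psdmx W : pdmx W -> psdmx W.
Proof.
move=> [Wsym Wpd]; split=> // v; have [->|/Wpd/ltW//] := eqVneq v 0.
by rewrite quad0.
Qed.

Lemma normW0 W : normW W 0 = 0.
Proof. by rewrite /normW quad0 sqrtr0. Qed.

Lemma normW_ge0 W v : 0 <= normW W v.
Proof. exact: sqrtr_ge0. Qed.

Lemma normW_sqr W v : psdmx W -> normW W v ^+ 2 = quad W v.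
Proof. by move=> [_ W0]; rewrite sqr_sqrtr. Qed.

Lemma normW_gt0 W v : pdmx W -> v != 0 -> 0 < normW W v.
Proof. by move=> [_ W0] v0; rewrite sqrtr_gt0 W0. Qed.

(** Squaring reduces this to Cauchy-Schwarz for [W]. The form with a difference serves to bound
    [v = (s + v) - s]. *)
Lemma ler_normWB W u v : psdmx W ->
  normW W (u - v) <= normW W u + normW W v.
Proof.
move=> Wpsd; have Wsym := Wpsd.1.
rewrite -(ler_pXn2r (n := 2)) ?nnegrE ?addr_ge0 ?normW_ge0 //.
rewrite sqrrD !normW_sqr // quadE -scaleN1r.
rewrite !bilinDl !bilinDr !bilinZl !bilinZr (bilinC v u) // -!quadE.
have := psd_cauchy_schwarz u v Wpsd.
rewrite -!normW_sqr // -exprMn.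
have := normW_ge0 W u; have := normW_ge0 W v.
set a := normW W u; set b := normW W v => b0 a0.
rewrite -[X in X <= _]real_normK ?num_real //.
rewrite ler_pXn2r ?nnegrE ?mulr_ge0 // => h.
have := ler_norm (- bilin W u v); rewrite normrN.
by lra.
Qed.

End BilinearForm.

(** * Symmetric trilinear forms and the bound by [Lambda] *)

Section Tensor.
Context {R : realType} {n : nat}.
Variable (T : 'I_n -> 'I_n -> 'I_n -> R).
Implicit Types (W : 'M[R]_n) (u v w : 'cV[R]_n).

Definition trilin u v w : R :=
  \sum_i \sum_j \sum_k T i j k * u i 0 * v j 0 * w k 0.

Lemma tensor_appE u v : tensor_app T u v = trilin u v v. Proof. by []. Qed.

Lemma tensor_cubeE u : tensor_cube T u = trilin u u u. Proof. by []. Qed.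

Lemma trilinDl u1 u2 v w : trilin (u1 + u2) v w = trilin u1 v w + trilin u2 v w.
Proof.
rewrite /trilin -big_split; apply: eq_bigr => i _ /=.
rewrite -big_split; apply: eq_bigr => j _ /=.
by rewrite -big_split; apply: eq_bigr => k _ /=; rewrite mxE; ring.
Qed.

Lemma trilin0l v w : trilin 0 v w = 0.
Proof.
rewrite /trilin big1 // => i _; rewrite big1 // => j _; rewrite big1 // => k _.
by rewrite mxE mulr0 !mul0r.
Qed.

Hypothesis T_sym : symmetric_tensor T.

Lemma trilinCr u v w : trilin u v w = trilin u w v.
Proof.
apply: eq_bigr => i _; rewrite exchange_big; apply: eq_bigr => j _ /=.
by apply: eq_bigr => k _; case: (T_sym i k j) => -> _ _ _ _; ring.
Qed.

Lemma trilinCl u v w : trilin u v w = trilin v u w.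
Proof.
rewrite /trilin exchange_big; apply: eq_bigr => i _; apply: eq_bigr => j _ /=.
by apply: eq_bigr => k _; case: (T_sym j i k) => _ -> _ _ _; ring.
Qed.

Lemma bilin_tensor_mx u v w : bilin (tensor_mx T u) v w = trilin u v w.
Proof.
(* [tensor_mx] contracts the third index, so [u] is first moved to the last slot. *)
rewrite trilinCl trilinCr bilin_sum.
apply: eq_bigr => i _; apply: eq_bigr => j _.
by rewrite mxE !mulr_suml; apply: eq_bigr => k _; ring.
Qed.

Lemma tensor_cubeD u v : tensor_cube T (u + v) =
  tensor_cube T u + 3 * trilin u u v + 3 * trilin u v v + tensor_cube T v.
Proof.
rewrite !tensor_cubeE !trilinDl.
rewrite !(trilinCl _ (u + v)) !trilinDl !(trilinCr _ _ (u + v)).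
rewrite !(trilinCl _ (u + v)) !trilinDl.
have e1 : trilin v u u = trilin u u v by rewrite trilinCl trilinCr.
have e2 : trilin v u v = trilin u v v by rewrite trilinCl.
have e3 : trilin v v u = trilin u v v by rewrite trilinCr trilinCl.
have e4 : trilin u v u = trilin u u v by rewrite trilinCr.
by rewrite e1 e2 e3 e4; ring.
Qed.

Lemma symmetric_tensor_mx u : tensor_mx T u \is symmetricmx.
Proof.
rewrite symmetricmxE; apply/eqP/matrixP => i j; rewrite !mxE; apply: eq_bigr => k _.
by case: (T_sym i j k) => _ ->.
Qed.

(** The substance is that the ratios defining [Lambda] are bounded above, so that their [sup]
    dominates each of them. Zero vectors, excluded from these ratios, are treated apart. *)
Lemma tensor_app_le W u v : (0 < n)%N -> pdmx W ->
  `|tensor_app T u v| <= Lambda T W * (normW W u * normW W v ^+ 2).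
Proof.
move=> n0 Wpd; have Wpsd := pdmx_psdmx Wpd.
have [_ Wl] := lambda_minP n0 Wpd.1.
have mu0 := lambda_min_gt0 n0 Wpd.
set mu := lambda_min W in Wl mu0.
have [->|u0] := eqVneq u 0.
  by rewrite tensor_appE trilin0l normr0 normW0 mul0r mulr0.
have [->|v0] := eqVneq v 0.
  by rewrite tensor_appE trilinCl trilin0l normr0 normW0 expr0n !mulr0.
rewrite -ler_pdivrMr; last by rewrite mulr_gt0 ?exprn_gt0 ?normW_gt0.
apply: ub_le_sup; last by exists u, v.
(* Since [mu * |x|^2 <= quad W x], each coordinate of [x] is at most [c * normW W x]; the three
   vector factors of a term then contribute [c ^+ 3]. *)
pose c := Num.sqrt mu^-1.
have hc (x : 'cV[R]_n) i : `|x i 0| <= c * normW W x.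
  rewrite -sqrtrM ?invr_ge0 ?(ltW mu0) // -sqrtr_sqr ler_wsqrtr //.
  by rewrite ler_pdivlMl // (le_trans _ (Wl x)) // ler_pM2l ?sqr_le_sqnorm.
exists ((\sum_i \sum_j \sum_k `|T i j k|) * c ^+ 3) => _ [x [y [x0 y0 ->]]].
rewrite ler_pdivrMr; last by rewrite mulr_gt0 ?exprn_gt0 ?normW_gt0.
rewrite -mulrA mulr_suml.
apply: (le_trans (ler_norm_sum _ _ _)); apply: ler_sum => i _.
rewrite mulr_suml.
apply: (le_trans (ler_norm_sum _ _ _)); apply: ler_sum => j _.
rewrite mulr_suml.
apply: (le_trans (ler_norm_sum _ _ _)); apply: ler_sum => k _.
rewrite -2!(mulrA (T i j k)) normrM ler_wpM2l // -mulrA !normrM.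
have -> : c ^+ 3 * (normW W x * normW W y ^+ 2)
  = (c * normW W x) * ((c * normW W y) * (c * normW W y)) by ring.
by rewrite ler_pM ?mulr_ge0 // ler_pM.
Qed.

(** In [tensor_app_le] at [u], [u], the factor multiplying [Lambda] is positive. *)
Lemma Lambda_ge0 W u : (0 < n)%N -> pdmx W -> u != 0 -> 0 <= Lambda T W.
Proof.
move=> n0 Wpd u0; have r0 := normW_gt0 Wpd u0.
have := le_trans (normr_ge0 _) (tensor_app_le u u n0 Wpd).
by rewrite pmulr_lge0 // mulr_gt0 // exprn_gt0.
Qed.

End Tensor.

(** * Increments of the quartic model and global minimality *)

Section QuarticModel.
Context {R : realType} {n : nat}.
Variables (f0 : R) (g : 'cV[R]_n) (H : 'M[R]_n).
Variables (T : 'I_n -> 'I_n -> 'I_n -> R) (sigma : R) (W : 'M[R]_n).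
Variable (s : 'cV[R]_n).
Hypotheses (H_sym : H \is symmetricmx) (T_sym : symmetric_tensor T).
Hypotheses (W_pd : pdmx W).

(** Stationarity eliminates [g], which cancels the [H] and [T] terms linear in [v]. The remaining
    [bilin W s v] is half of [p^2 - r^2 - quad W v], where [p] and [r] are the norms of [s + v] and
    [s]; this completes the square in [p^2 - r^2]. The cubic part [T[s][v]^2 / 2 + T[v]^3 / 6] is
    split as [T[s][v]^2 / 3 + T[s + v][v]^2 / 6]. *)
Lemma m3_increment (v : 'cV[R]_n) :
  (H + 2^-1 *: tensor_mx T s + (sigma * normW W s ^+ 2) *: W) *m s = - g ->
  m3 f0 g H T sigma W (s + v) - m3 f0 g H T sigma W s
  = 2^-1 * (quad H v + 2 / 3 * tensor_app T s v
            + sigma * normW W s ^+ 2 * quad W v)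
    + 6^-1 * tensor_app T (s + v) v
    + sigma / 4 * (normW W (s + v) ^+ 2 - normW W s ^+ 2) ^+ 2.
Proof.
move=> s_eq; have Wpsd := pdmx_psdmx W_pd.
have Hg : bilin 1%:M g v = - (bilin H s v + 2^-1 * trilin T s s v
            + sigma * normW W s ^+ 2 * bilin W s v).
  rewrite -[g]opprK -s_eq -scaleN1r bilinZl bilinC ?mulN1r; last first.
    by rewrite symmetricmxE tr_scalar_mx.
  rewrite -bilin_mul !bilinDm !bilinZm (bilin_tensor_mx T_sym).
  by rewrite (bilinC v s H_sym) (bilinC v s W_pd.1) (trilinCr T_sym).
rewrite /m3 (tensor_cubeD T_sym) !bilin_mx11 !bilinDr Hg !tensor_appE.
rewrite trilinDl -(tensor_cubeE T v).
(* Once fourth powers are squares of squares, [normW_sqr] removes all square roots and a polynomial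
   identity in the forms remains. *)
have p4 : normW W (s + v) ^+ 4 = (normW W (s + v) ^+ 2) ^+ 2 by rewrite -exprM.
have r4 : normW W s ^+ 4 = (normW W s ^+ 2) ^+ 2 by rewrite -exprM.
rewrite p4 r4 !normW_sqr // !quadE !bilinDl !bilinDr.
rewrite (bilinC v s H_sym) (bilinC v s W_pd.1).
by field.
Qed.

Lemma m3_global_min : (0 < n)%N -> 0 < sigma ->
  (H + 2^-1 *: tensor_mx T s + (sigma * normW W s ^+ 2) *: W) *m s = - g ->
  (forall v, 0 <= quad H v + 2 / 3 * tensor_app T s v
     + (sigma * normW W s ^+ 2 - Lambda T W / 3 * normW W s
        - Lambda T W ^+ 2 / (18 * sigma)) * quad W v) ->
  forall q, m3 f0 g H T sigma W s <= m3 f0 g H T sigma W q.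
Proof.
move=> n0 sigma0 s_eq posS q; have Wpsd := pdmx_psdmx W_pd.
rewrite -subr_ge0.
have -> : q = s + (q - s) by rewrite addrC subrK.
move: (q - s) => v; rewrite m3_increment //.
have := posS v.
have := tensor_app_le T_sym (s + v) v n0 W_pd.
have := ler_normWB (s + v) s Wpsd; rewrite addrAC subrr add0r.
rewrite -(normW_sqr v Wpsd).
have := normW_ge0 W s; have := normW_ge0 W (s + v); have := normW_ge0 W v.
move: (normW W s) (normW W (s + v)) (normW W v) => r p b.
move: (tensor_app T s v) (tensor_app T (s + v) v) (quad H v) => t1 t2 h.
move: (Lambda T W) => L b0 p0 r0 tri; rewrite ler_norml => /andP[t2L _] pos.
have sq : b ^+ 2 <= (p + r) ^+ 2 by rewrite ler_pXn2r ?nnegrE ?addr_ge0.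
have h1 : sigma / 4 * ((p - r) ^+ 2 * b ^+ 2)
          <= sigma / 4 * (p ^+ 2 - r ^+ 2) ^+ 2.
  by rewrite subr_sqr exprMn !ler_wpM2l ?sqr_ge0 ?divr_ge0 ?(ltW sigma0).
(* The tensor term [- L p b^2 / 6] is split along [p = (p - r) + r]: the part with [r] is paid for
   by [L / 3 * r] in (S), and the other is minimized jointly with the quartic term, at
   [p - r = L / (3 * sigma)]. *)
have h2 : - (L ^+ 2 / (36 * sigma)) <= sigma / 4 * (p - r) ^+ 2 - L / 6 * (p - r).
  rewrite -subr_ge0.
  have -> : sigma / 4 * (p - r) ^+ 2 - L / 6 * (p - r)
    - - (L ^+ 2 / (36 * sigma))
    = (sigma / 2 * (p - r) - L / 6) ^+ 2 / sigma.
    by field; rewrite gt_eqF.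
  by rewrite divr_ge0 ?sqr_ge0 ?(ltW sigma0).
have h3 := ler_wpM2r (sqr_ge0 b) h2.
have e : L ^+ 2 / (18 * sigma) = 2 * (L ^+ 2 / (36 * sigma)).
  by field; rewrite gt_eqF.
rewrite e in pos.
(* Naming the quotient leaves a division by [sigma] out of the final inequality. *)
move: (L ^+ 2 / (36 * sigma)) pos h3 => K pos h3.
by nra.
Qed.

End QuarticModel.

Theorem lemma2p2 (R : realType) (n : nat)
    (f0 : R) (g : 'cV[R]_n) (H : 'M[R]_n) (T : 'I_n -> 'I_n -> 'I_n -> R)
    (sigma : R) (W : 'M[R]_n) (s_ : 'cV[R]_n)
    (H_sym : H \is symmetricmx)
    (T_sym : symmetric_tensor T)
    (sigma_gt0 : 0 < sigma)
    (W_pd : pdmx W)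
    (s_neq0 : s_ != 0)
    (s_eq : (H + 2^-1 *: tensor_mx T s_ + (sigma * normW W s_ ^+ 2) *: W) *m s_
            = - g)
    (sigma_ge : 3 * Num.max
                  (- lambda_min H * normW W s_ ^- 2 * (lambda_min W)^-1)
                  (7 / 3 * Lambda T W * (normW W s_)^-1)
                <= sigma) :
  let N := psdmx (H + (2 / 3) *: tensor_mx T s_
                  + (sigma * normW W s_ ^+ 2) *: W
                  + (Lambda T W / 3 * normW W s_) *: W) in
  let S := psdmx (H + (2 / 3) *: tensor_mx T s_
                  + (sigma * normW W s_ ^+ 2) *: W
                  - (Lambda T W / 3 * normW W s_) *: W
                  - (Lambda T W ^+ 2 / (18 * sigma)) *: W) in
  (N <-> S) /\
  (N -> forall s : 'cV[R]_n,
     m3 f0 g H T sigma W s_ <= m3 f0 g H T sigma W s).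
Proof.
(* In dimension zero every vector is zero, contrary to [s_neq0]. *)
have n0 : (0 < n)%N.
  rewrite lt0n; apply: contraNneq s_neq0 => n_eq0.
  by apply/eqP/matrixP => i; have := ltn_ord i; rewrite {2}n_eq0.
have Wpsd := pdmx_psdmx W_pd; have [Hs Ws] := (H_sym, W_pd.1).
have r0 := normW_gt0 W_pd s_neq0.
have L0 := Lambda_ge0 T_sym n0 W_pd s_neq0.
have w0 := lambda_min_gt0 n0 W_pd.
have [_ Hl] := lambda_minP n0 H_sym; have [_ Wl] := lambda_minP n0 Ws.
have [sigmaH sigmaL] : - lambda_min H <= sigma / 3 * normW W s_ ^+ 2 * lambda_min W
    /\ 7 * Lambda T W <= sigma * normW W s_.
  move: sigma_ge; rewrite mulrC -ler_pdivlMr // ge_max => /andP[].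
  by rewrite !ler_pdivrMr ?exprn_gt0 // => h1 h2; split=> //; lra.
set r := normW W s_ in r0 sigmaH sigmaL *.
set L := Lambda T W in L0 sigmaL *.
have symD (a b : R) : (H + a *: tensor_mx T s_ + b *: W) \is symmetricmx.
  have Ts := symmetric_tensor_mx T_sym s_.
  move: Hs Ws Ts; rewrite !symmetricmxE => /eqP HT /eqP WT /eqP TT.
  by rewrite !linearD /= !linearZ /= HT WT TT.
(* Count multiples of [quad W v]: [H] costs at most [sigma r^2 / 3] and the tensor [2 L r / 3]. The
   remaining [2 sigma r^2 / 3] is at least [14 L r / 3], which covers these [2 L r / 3], the
   [L r / 3] of (S), and its last term, bounded crudely by [L r]. *)
have posS v : 0 <= quad H v + 2 / 3 * tensor_app T s_ v
     + (sigma * r ^+ 2 - L / 3 * r - L ^+ 2 / (18 * sigma)) * quad W v.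
  have Hv : - (sigma / 3 * r ^+ 2 * quad W v) <= quad H v.
    apply: le_trans (Hl v).
    have c0 : 0 <= sigma / 3 * r ^+ 2.
      by rewrite mulr_ge0 ?sqr_ge0 ?divr_ge0 ?(ltW sigma_gt0).
    have := ler_wpM2l c0 (Wl v).
    have := ler_wpM2r (sqnorm_ge0 v) sigmaH.
    by lra.
  have := tensor_app_le T_sym s_ v n0 W_pd.
  rewrite normW_sqr // -/r -/L ler_norml => /andP[Tv _].
  have Wv := Wpsd.2 v.
  have Lr : 7 * (L * r) <= sigma * r ^+ 2.
    by rewrite expr2 !mulrA ler_pM2r.
  have LL : L ^+ 2 / (18 * sigma) <= L * r.
    rewrite ler_pdivrMr ?mulr_gt0 //.
    by have := ler_wpM2l L0 sigmaL; have : 0 <= L ^+ 2 := sqr_ge0 L; lra.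
  have Lr0 : 0 <= L * r by rewrite mulr_ge0 // ltW.
  have := mulr_ge0 Lr0 Wv.
  have := ler_wpM2r Wv Lr; have := ler_wpM2r Wv LL.
  by lra.
have quadS (a b : R) v : quad (H + a *: tensor_mx T s_ + b *: W) v
    = quad H v + a * tensor_app T s_ v + b * quad W v.
  by rewrite quadE !bilinDm !bilinZm (bilin_tensor_mx T_sym).
have HS : psdmx (H + (2 / 3) *: tensor_mx T s_
                  + (sigma * r ^+ 2) *: W
                  - (L / 3 * r) *: W
                  - (L ^+ 2 / (18 * sigma)) *: W).
  (* All multiples of [W] are gathered into a single coefficient, the shape that [symD] and [quadS]
     expect. *)
  rewrite -!addrA -!scaleNr -!scalerDl addrA; split; first exact: symD.
  by move=> v; rewrite quadS addrA; apply: posS.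
have HN : psdmx (H + (2 / 3) *: tensor_mx T s_
                  + (sigma * r ^+ 2) *: W + (L / 3 * r) *: W).
  rewrite -!addrA -!scalerDl addrA; split; first exact: symD.
  (* (N) differs from (S) only by a larger coefficient of [W]. *)
  move=> v; apply: le_trans (posS v) _.
  rewrite quadS lerD2l ler_wpM2r ?(Wpsd.2 v) //.
  have : 0 <= L ^+ 2 / (18 * sigma).
    by rewrite divr_ge0 ?sqr_ge0 // mulr_ge0 // ltW.
  by have : 0 <= L * r; [rewrite mulr_ge0 // ltW | lra].
move=> N S; split; first by split.
by move=> _; apply: m3_global_min.
Qed.
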